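(* Let $\ell$ be a prime power and let $\mathcal{C}$ be a plane conic in $PG(3,\ell^6)$. Then the size $|\mathcal{C}\cap \mathcal{GK}(\mathbb{F}_{\ell^6})|$ is at most $$\begin{cases} 2(\ell^2-\ell+1) & \text{if } \mathcal{C} \text{ is reducible},\\ 2(\ell+1) & \text{if } \mathcal{C} \text{ is absolutely irreducible}.\end{cases}$$
   Context: $\ell=p^h$ with $p$ prime and $h\ge 1$. $PG(3,\ell^6)$ is the three-dimensional projective space over the field $\mathbb{F}_{\ell^6}$, with homogeneous coordinates $(X:Y:Z:T)$; affine points are those with $T=1$. The Giulietti-Korchmáros curve $\mathcal{GK}$ is the non-singular projective curve in $PG(3,\ell^6)$ with affine equations $$Z^{\ell^2-\ell+1}=Y^{\ell^2}-Y,\qquad Y^{\ell+1}=X^\ell+X,$$ having a unique point at infinity $P_\infty=(1:0:0:0)$. $\mathcal{GK}(\mathbb{F}_{\ell^6})$ denotes the set of its $\mathbb{F}_{\ell^6}$-rational points (including $P_\infty$). A plane conic is a curve of degree $2$ contained in a plane of $PG(3,\ell^6)$, defined over $\mathbb{F}_{\ell^6}$; it is reducible if it splits into two lines. *)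

(* Defs.v *)
From HB Require Import structures.
From mathcomp Require Import all_boot all_order all_algebra all_field.
From mathcomp Require Export mpoly.

Set Implicit Arguments.
Unset Strict Implicit.
Unset Printing Implicit Defensive.

Import GRing.Theory.
Local Open Scope ring_scope.

(* A point of PG(3, F) is a one-dimensional subspace of F^4, encoded by its
   canonical generating matrix: for nonzero u and v, ppoint u = ppoint v iff u
   and v are proportional. *)
Definition ppoint (F : fieldType) (v : 'rV[F]_4) : 'M[F]_4 := <<v>>%MS.

Definition coords (F : fieldType) (x y z t : F) : 'rV[F]_4 :=
  \row_(j < 4) [:: x; y; z; t]`_j.

(* The affine rational points, together with P_oo = (1 : 0 : 0 : 0).
   Homogenizing the two affine equations would not do: at T = 0 they cut out
   the whole line Y = T = 0 instead of P_oo alone. *)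
Definition GK_points (F : finFieldType) (ell : nat) : {set 'M[F]_4} :=
  ppoint (coords 1 0 0 0) |:
  [set ppoint (coords w.1.1 w.1.2 w.2 1) | w : F * F * F &
     (w.2 ^+ (ell ^ 2 - ell + 1) == w.1.2 ^+ (ell ^ 2) - w.1.2)
       && (w.1.2 ^+ ell.+1 == w.1.1 ^+ ell + w.1.1)].

(* The plane is the row space of a 3 x 4 matrix of full rank, whose rows give
   homogeneous coordinates on it; a curve of degree 2 in the plane is a nonzero
   quadratic form in these coordinates. *)
Record plane_conic (F : fieldType) := PlaneConic {
  conic_frame : 'M[F]_(3, 4);
  conic_form : {mpoly F[3]};
  conic_frame_free : row_free conic_frame;
  conic_form_homog : conic_form \is 2.-homog;
  conic_form_neq0 : conic_form != 0
}.

Definition conic_points (F : finFieldType) (C : plane_conic F) :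
    {set 'M[F]_4} :=
  [set ppoint (u *m conic_frame C) | u : 'rV[F]_3 &
     (u != 0) && ((conic_form C).@[fun i => u 0 i] == 0)].

Definition irreducible_elt (R : idomainType) (a : R) : Prop :=
  [/\ a != 0, a \isn't a GRing.unit &
      forall b c : R, a = b * c ->
        b \is a GRing.unit \/ c \is a GRing.unit].

(* In the next two definitions iota is meant to embed F into an algebraic
   closure K: the two lines need not be defined over F, and may coincide. *)
Definition conic_reducible (F K : fieldType) (iota : {rmorphism F -> K})
    (C : plane_conic F) : Prop :=
  exists a b : {mpoly K[3]},
    [/\ a != 0, b != 0, a \is 1.-homog, b \is 1.-homog &
        map_mpoly iota (conic_form C) = a * b].

Definition conic_abs_irreducible (F K : fieldType)
    (iota : {rmorphism F -> K}) (C : plane_conic F) : Prop :=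
  irreducible_elt (map_mpoly iota (conic_form C)).

(* Main.v *)
Require Import Defs.
From HB Require Import structures.
From mathcomp Require Import all_boot all_order all_algebra all_field.
From mathcomp Require Import ring zify.

(* Up to scaling, every point of GK satisfies the homogenized Hermitian equation
   h = X^ell T + X T^ell - Y^(ell+1) = 0, in which Z does not occur.

   A line, or an irreducible conic with a rational point, is parametrized by
   tau |-> (1, tau, ..., tau^n) A with n = 1 or n = 2.  Along it h becomes a
   polynomial of degree at most (ell+1) n whose coefficient at ell i + j collects
   the (i, j) entries of the Gram matrix of the sesquilinear form of h, so there
   are at most (ell+1) n points unless this polynomial vanishes.  On a conic it
   never does: the whole plane would be totally isotropic, whereas the form has
   rank 3 on the 4-dimensional space.  On a line it may, but then the points of
   the curve on it share the same X and Y, and Z^(ell^2-ell+1) is constant.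

   A reducible conic splits over K only; the rational points of each of its two
   lines nevertheless lie on a rational line. *)

Set Implicit Arguments.
Unset Strict Implicit.
Unset Printing Implicit Defensive.

Import GRing.Theory.
Local Open Scope ring_scope.

(** * The Hermitian form along a parametrized line or conic *)

Lemma ord3_cases (i : 'I_3) :
  [|| i == ord0, i == lift ord0 ord0 | i == lift ord0 (lift ord0 ord0)].
Proof. by case: i => [[|[|[|//]]] hi]. Qed.

Definition power_row (F : fieldType) n (tau : F) : 'rV[F]_n := \row_(i < n) tau ^+ i.

Section HermitianForm.

Variables (F : fieldType) (sigma : {rmorphism F -> F}).

(** [bump 2] skips the index of Z, which leaves the columns X, Y, T. *)
Definition drop_Z : 'M[F]_(4, 3) := \matrix_(i, j) (i == bump 2 j :> nat)%:R.

Definition herm_mx : 'M[F]_3 :=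
  \matrix_(i, j) (((i + j == 2) && (i != 1%N :> nat))%:R
    - ((i == 1%N :> nat) && (j == 1%N :> nat))%:R).

Definition gram n (A : 'M[F]_(n, 4)) : 'M[F]_n :=
  map_mx sigma (A *m drop_Z) *m herm_mx *m (A *m drop_Z)^T.

(** Semilinear in [v] and linear in [w]. As [sigma] need not be an involution, the vanishing of
    [herm v w] need not entail that of [herm w v]. *)
Definition herm (v w : 'rV[F]_4) : F :=
  (map_mx sigma (v *m drop_Z) *m herm_mx *m (w *m drop_Z)^T) 0 0.

Lemma herm_coords x y z t x' y' z' t' :
  herm (coords x y z t) (coords x' y' z' t') =
  sigma x * t' + sigma t * x' - sigma y * y'.
Proof.
rewrite /herm /coords; do !rewrite !mxE !big_ord_recl !big_ord0 /=.
rewrite /bump /= !(mulr0, mulr1, add0r, addr0, rmorph0, subr0, sub0r, oppr0).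
rewrite !mxE /= /bump /= !(mulr0, mulr1, add0r, addr0); ring.
Qed.

Lemma herm_comb n (c d : 'rV[F]_n) (A : 'M[F]_(n, 4)) :
  herm (c *m A) (d *m A) = (map_mx sigma c *m gram A *m d^T) 0 0.
Proof. by rewrite /herm /gram -!mulmxA map_mxM !trmx_mul !mulmxA. Qed.

Lemma herm_scale k l (v w : 'rV[F]_4) :
  herm (k *: v) (l *: w) = sigma k * l * herm v w.
Proof.
rewrite /herm -!scalemxAl map_mxZ linearZ /= -!(scalemxAl, scalemxAr) !mxE.
exact: mulrA.
Qed.

Lemma drop_ZK : drop_Z^T *m drop_Z = 1%:M.
Proof.
apply/matrixP=> i j; rewrite !mxE !big_ord_recl !big_ord0 !mxE /=.
case: i => [[|[|[|//]]] hi]; case: j => [[|[|[|//]]] hj];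
  by rewrite /bump /= !(mulr0, mulr1, add0r, addr0).
Qed.

Lemma herm_mxK : herm_mx *m herm_mx = 1%:M.
Proof.
apply/matrixP=> i j; rewrite !mxE !big_ord_recl !big_ord0 !mxE /=.
case: i => [[|[|[|//]]] hi]; case: j => [[|[|[|//]]] hj];
  by rewrite /bump /=; ring.
Qed.

Lemma rank_drop_Z : \rank drop_Z = 3%N.
Proof.
apply/eqP; rewrite eqn_leq rank_leq_col /=.
by rewrite -{1}(mxrank1 F 3) -drop_ZK mxrankM_maxr.
Qed.

Lemma herm_mx_unit : herm_mx \in unitmx.
Proof. by have [] := mulmx1_unit herm_mxK. Qed.

Lemma mxrank_herm n (M : 'M[F]_(n, 3)) :
  \rank (map_mx sigma M *m herm_mx) = \rank M.
Proof. by rewrite mxrankMfree ?mxrank_map // row_free_unit herm_mx_unit. Qed.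

Lemma rank_frame_drop_Z n (A : 'M[F]_(n, 4)) :
  row_free A -> (n <= (\rank (A *m drop_Z)).+1)%N.
Proof.
move=> /eqP rA; have := mxrank_mul_min A drop_Z.
by rewrite rA rank_drop_Z; lia.
Qed.

(** Both factors of a vanishing [gram A] have the rank of [A *m drop_Z], and the ranks of two
    factors with product 0 sum to at most the inner dimension 3. *)
Lemma gram0_rank n (A : 'M[F]_(n, 4)) :
  gram A = 0 -> ((\rank (A *m drop_Z)).*2 <= 3)%N.
Proof.
move/mulmx0_rank_max; rewrite mxrank_tr mxrank_herm; lia.
Qed.

Section RestrictedForm.

Variable ell : nat.
Hypothesis sigmaE : forall x, sigma x = x ^+ ell.

Definition herm_poly n (A : 'M[F]_(n, 4)) : {poly F} :=
  \sum_(i < n) \sum_(j < n) gram A i j *: 'X^(ell * i + j).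

Lemma herm_polyE n (A : 'M[F]_(n, 4)) tau :
  (herm_poly A).[tau] = herm (power_row n tau *m A) (power_row n tau *m A).
Proof.
rewrite herm_comb /herm_poly exchange_big /= horner_sum [RHS]mxE.
apply: eq_bigr => j _; rewrite horner_sum !mxE mulr_suml.
apply: eq_bigr => i _; rewrite !mxE hornerZ hornerXn exprD sigmaE.
by rewrite -exprM [(i * ell)%N]mulnC; ring.
Qed.

Lemma coef_herm_poly n (A : 'M[F]_(n, 4)) k :
  (herm_poly A)`_k = \sum_(i < n) \sum_(j < n) gram A i j * (k == ell * i + j)%:R.
Proof.
rewrite coef_sum; apply: eq_bigr => i _; rewrite coef_sum.
by apply: eq_bigr => j _; rewrite coefZ coefXn.
Qed.

(** Since [j < n <= ell], the exponents [ell * i + j] are pairwise distinct, so each coefficient is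
    a single Gram entry. *)
Lemma herm_poly0_gram0 n (A : 'M[F]_(n, 4)) :
  (n <= ell)%N -> herm_poly A = 0 -> gram A = 0.
Proof.
move=> n_le A0; apply/matrixP=> i j; rewrite [RHS]mxE.
have := coef_herm_poly A (ell * i + j); rewrite A0 coef0.
rewrite (bigD1 i) //= (bigD1 j) //= eqxx mulr1 !big1 ?addr0 //.
  move=> i' i'i; apply: big1 => j' _; case: eqP => [e|_]; rewrite ?mulr0 //.
  by case/negP: i'i; apply/eqP/val_inj; have /= := (ltn_ord j, ltn_ord j'); case; nia.
move=> j' j'j; case: eqP => [e|_]; rewrite ?mulr0 //.
by case/negP: j'j; apply/eqP/val_inj => /=; lia.
Qed.

(* The last row of [A] is the point at infinity of the parametrization
   [tau |-> power_row n tau *m A]; when it is isotropic the degree drops. *)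
Lemma size_herm_poly n (A : 'M[F]_(n.+1, 4)) : (0 < ell)%N ->
  (size (herm_poly A) <= (ell.+1 * n).+1 - (gram A ord_max ord_max == 0%R))%N.
Proof.
move=> ell_gt0; apply/leq_sizeP => k; rewrite coef_herm_poly => k_ge.
apply: big1 => i _; apply: big1 => j _; case: eqP => [ek|_]; rewrite ?mulr0 //.
have hi := ltn_ord i; have hj := ltn_ord j.
have [ei ej] : i = n :> nat /\ j = n :> nat.
  by move: k_ge; rewrite ek; case: eqP => _; nia.
have -> : i = ord_max by apply: val_inj.
have -> : j = ord_max by apply: val_inj.
move: k_ge; rewrite ek ei ej; case: eqP => [-> //|_]; first by rewrite mul0r.
by nia.
Qed.

Lemma herm_poly_conic_neq0 (A : 'M[F]_(3, 4)) :
  (1 < ell)%N -> row_free A -> herm_poly A != 0.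
Proof.
move=> ell_gt1 Afree; apply/eqP => A0.
suff /gram0_rank : gram A = 0 by have := rank_frame_drop_Z Afree; lia.
have [n_le|ell_lt3] := leqP 3 ell; first exact: herm_poly0_gram0 n_le A0.
have ell2 : ell = 2%N by lia.
(* The exponents 2 i + j now collide; what is missing is supplied by a vector
   [a] with [a *m M = 0], which annihilates the Gram matrix on both sides. *)
pose i1 : 'I_3 := lift ord0 ord0; pose i2 : 'I_3 := lift ord0 (lift ord0 ord0).
have c k := coef_herm_poly A k.
rewrite A0 ell2 in c.
have {}c k : 0 = _ := etrans (esym (coef0 _ k)) (c k).
have := (c 0, c 1, c 2, c 3, c 4, c 5, c 6)%N.
rewrite !big_ord_recl !big_ord0 /=.
rewrite -/i1 -/i2 /bump /= !(mulr0, mulr1, add0r, addr0).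
case=> [[[[[[g00 g01] g02] g11] g12] g21] g22].
set G := gram A in g00 g01 g02 g11 g12 g21 g22 *.
set M := A *m drop_Z.
(* The coefficients at 1, 3 and 5 are the middle column of [G], so [G] is singular, and with it
   [M]. *)
have [a a_neq0 aM] : exists2 a : 'rV_3, a != 0 & a *m M = 0.
  apply/det0P/contraT => detM; have Munit : M \in unitmx by rewrite unitmxE unitfE.
  have Gunit : G \in unitmx.
    by rewrite !unitmx_mul map_unitmx unitmx_tr -/M Munit herm_mx_unit.
  have : G *m delta_mx i1 (0 : 'I_1) = 0.
    apply/colP => i; rewrite -colE [LHS]mxE [RHS]mxE.
    by case/or3P: (ord3_cases i) => /eqP ->; rewrite -/i1 -?g01 -?g11 -?g21.
  move/(congr1 (mulmx (invmx G))); rewrite mulKmx // mulmx0.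
  by move/matrixP/(_ i1 0)/eqP; rewrite !mxE !eqxx oner_eq0.
have Ga i : G i ord0 * a 0 ord0 + G i i1 * a 0 i1 + G i i2 * a 0 i2 = 0.
  have : (G *m a^T) i 0 = 0.
    by rewrite /G /gram -mulmxA -trmx_mul aM trmx0 mulmx0 mxE.
  by rewrite mxE !big_ord_recl big_ord0 addr0 !mxE addrA.
have aG j : sigma (a 0 ord0) * G ord0 j + sigma (a 0 i1) * G i1 j
            + sigma (a 0 i2) * G i2 j = 0.
  have : (map_mx sigma a *m G) 0 j = 0.
    by rewrite /G /gram !mulmxA -map_mxM aM map_mx0 !mul0mx mxE.
  by rewrite mxE !big_ord_recl big_ord0 addr0 !mxE addrA.
have sigma_eq0 x : (sigma x == 0) = (x == 0) by exact: fmorph_eq0.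
(* With x = [G ord0 i2] and y = [G i1 i2], the rows of [G] are (0, 0, x), (-x, 0, y), (-y, 0, 0). If
   x or y is nonzero, the equations [Ga] and [aG] force [a = 0]. *)
have g20 : G i2 ord0 = - G i1 i2 by apply/eqP; rewrite -addr_eq0 addrC -g12.
have g10 : G i1 ord0 = - G ord0 i2 by apply/eqP; rewrite -addr_eq0 addrC -g02.
have := (Ga ord0, Ga i1, Ga i2, aG ord0, aG i1, aG i2).
rewrite g20 g10 -g00 -g01 -g11 -g21 -g22.
rewrite !(mulr0, mul0r, addr0, add0r, mulNr, mulrN).
case=> [[[[[e1 e2] e3] e4] _] e5].
have a0 : a 0 ord0 = 0 -> a 0 i1 = 0 -> a 0 i2 = 0 -> False.
  move=> a0 a1 a2; case/negP: a_neq0; apply/eqP/rowP => j; rewrite [RHS]mxE.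
  by case/or3P: (ord3_cases j) => /eqP ->.
have x0 : G ord0 i2 = 0.
  apply/eqP/negPn/negP => x_neq0.
  have a2 : a 0 i2 = 0 by apply/eqP; move/eqP: e1; rewrite mulf_eq0 (negPf x_neq0).
  move: e2 e4; rewrite a2 mulr0 rmorph0 mul0r subr0 addr0 => /eqP + /eqP.
  rewrite !oppr_eq0 !mulf_eq0 (negPf x_neq0) orbF sigma_eq0 /= => /eqP ? /eqP ?.
  exact: a0.
have y0 : G i1 i2 = 0.
  apply/eqP/negPn/negP => y_neq0; move: e2 e3 e5.
  rewrite x0 mul0r mulr0 oppr0 !add0r => /eqP + /eqP + /eqP.
  rewrite !oppr_eq0 !mulf_eq0 (negPf y_neq0) orbF sigma_eq0 /= => /eqP ? /eqP ? /eqP ?.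
  exact: a0.
rewrite x0 y0 oppr0 in g10 g20; apply/matrixP => i j; rewrite [RHS]mxE.
by case/or3P: (ord3_cases i) => /eqP ->; case/or3P: (ord3_cases j) => /eqP ->.
Qed.

Lemma herm_line_poly0 (A : 'M[F]_(2, 4)) (c d : 'rV[F]_2) :
  (1 < ell)%N -> herm_poly A = 0 -> herm (c *m A) (d *m A) = 0.
Proof.
by move=> ell_gt1 /herm_poly0_gram0 gA; rewrite herm_comb gA // mulmx0 mul0mx mxE.
Qed.

End RestrictedForm.
End HermitianForm.

(** * Points of the curve on a parametrized line or conic *)

Section Points.
Variables (F : finFieldType).

Lemma ppoint_scale (k : F) (v : 'rV[F]_4) : k != 0 -> ppoint (k *: v) = ppoint v.
Proof. by move=> k0; apply/genmxP; rewrite !eqmx_scale // submx_refl. Qed.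

Lemma ppoint_eq (v w : 'rV[F]_4) :
  v != 0 -> ppoint v = ppoint w -> exists2 k, k != 0 & v = k *: w.
Proof.
move=> v0 /genmxP /andP[/sub_rVP[k vk] _]; exists k => //.
by apply: contra_neq v0 => k0; rewrite vk k0 scale0r.
Qed.

Lemma GK_pointsP ell X : X \in GK_points F ell ->
  X = ppoint (coords 1 0 0 0) \/
  exists x y z, [/\ X = ppoint (coords x y z 1),
    z ^+ (ell ^ 2 - ell + 1) = y ^+ (ell ^ 2) - y & y ^+ ell.+1 = x ^+ ell + x].
Proof.
rewrite in_setU1 => /orP[/eqP ->|/imsetP[[[x y] z]]]; first by left.
rewrite inE /= => /andP[/eqP ez /eqP ey] ->; right.
by exists x, y, z.
Qed.

Variables (ell : nat) (sigma : {rmorphism F -> F}).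
Hypothesis sigmaE : forall x, sigma x = x ^+ ell.

Lemma GK_points_herm X v : v != 0 -> X \in GK_points F ell -> X = ppoint v ->
  herm sigma v v = 0.
Proof.
move=> v0 /GK_pointsP[->|[x [y [z [-> _ e]]]]] /esym/(ppoint_eq v0)[k _ ->];
  rewrite herm_scale herm_coords ?(rmorph0, rmorph1).
  by ring.
rewrite -!sigmaE in e; move: e; rewrite exprS -sigmaE => e.
by rewrite [sigma y * y]mulrC e; ring.
Qed.

(** Finite parameters of points in [S] are roots of [herm_poly]. The point at infinity of the
    parametrization counts only if it is isotropic, and then the degree bound has dropped by one to
    make room for it. *)
Lemma card_param_points n (A : 'M[F]_(n.+1, 4)) (S : {set 'M[F]_4}) :
  (0 < ell)%N -> herm_poly sigma ell A != 0 -> row_free A ->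
  S \subset GK_points F ell ->
  (forall X, X \in S -> (exists tau, X = ppoint (power_row n.+1 tau *m A))
     \/ X = ppoint (row ord_max A)) ->
  (#|S| <= ell.+1 * n)%N.
Proof.
move=> ell_gt0 hA Afree S_GK SA.
pose T := [set tau | root (herm_poly sigma ell A) tau].
have cardT : (#|T| < (ell.+1 * n).+1 - (gram sigma A ord_max ord_max == 0%R))%N.
  apply: leq_trans (size_herm_poly sigma A ell_gt0).
  rewrite cardE; apply: max_poly_roots hA _ (enum_uniq _).
  by apply/allP => tau; rewrite mem_enum inE.
pose f tau := ppoint (power_row n.+1 tau *m A).
pose R := if gram sigma A ord_max ord_max == 0
  then [set ppoint (row ord_max A)] else set0.
have S_sub : S \subset (f @: T) :|: R.
  apply/subsetP => X XS; have XGK := subsetP S_GK X XS; rewrite inE.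
  have nz (u : 'rV_n.+1) : u != 0 -> u *m A != 0 by rewrite mulmx_free_eq0.
  have [[tau Xtau]|Xmax] := SA X XS.
    apply/orP; left; rewrite Xtau; apply/imset_f; rewrite inE.
    apply/eqP; rewrite herm_polyE //; apply: GK_points_herm XGK Xtau.
    apply: nz; apply/eqP => /rowP/(_ 0)/eqP.
    by rewrite !mxE expr0 oner_eq0.
  have e_neq0 : delta_mx 0 ord_max != 0 :> 'rV[F]_n.+1.
    by apply/eqP => /rowP/(_ ord_max)/eqP; rewrite !mxE !eqxx oner_eq0.
  have := GK_points_herm (nz _ e_neq0) XGK; rewrite -rowE => /(_ Xmax).
  rewrite rowE herm_comb map_delta_mx -rowE trmx_delta -colE mxE [X in X = 0]mxE => e.
  by apply/orP; right; rewrite /R e eqxx inE Xmax.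
have := leq_trans (subset_leq_card S_sub) (leq_card_setU _ _).
rewrite /R; move: cardT; have := leq_imset_card f T.
case: (gram _ _ _ _ == 0);
  rewrite ?cards1 ?cards0 (subn0, subn1) /= => fT cT /leq_trans; apply.
  by rewrite addn1 (leq_ltn_trans fT).
by rewrite addn0 (leq_trans fT).
Qed.

End Points.

(** * Lines *)

Section Lines.
Variables (F : finFieldType) (ell : nat) (sigma : {rmorphism F -> F}).
Hypothesis sigmaE : forall x, sigma x = x ^+ ell.
Hypothesis ell_gt1 : (1 < ell)%N.

Lemma coords_T1_neq0 (x y z : F) : coords x y z 1 != 0.
Proof. by apply/eqP => /rowP/(_ ord_max)/eqP; rewrite !mxE oner_eq0. Qed.

Lemma coords_P_infty_neq0 : coords 1 0 0 0 != 0 :> 'rV[F]_4.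
Proof. by apply/eqP => /rowP/(_ ord0)/eqP; rewrite !mxE oner_eq0. Qed.

(** The difference of [v] and [w] has T = 0, so expanding its [herm] value leaves only
    [- (sigma (y' - y) * (y' - y))], which must vanish. Then [herm v w = herm v v] gives the
    equality in X. *)
Lemma herm_isotropic_XY x y z x' y' z' :
  let v := coords x y z 1 in let w := coords x' y' z' 1 in
  [/\ herm sigma v v = 0, herm sigma v w = 0, herm sigma w v = 0 & herm sigma w w = 0] ->
  x' = x /\ y' = y.
Proof.
rewrite /= !herm_coords !rmorph1 !mulr1 !mul1r => -[vv vw wv ww].
have yy : y' = y.
  apply/eqP; rewrite -subr_eq0 -(orbb (_ == 0)) -{1}(fmorph_eq0 sigma) -mulf_eq0.
  apply/eqP; rewrite rmorphB.
  transitivity ((sigma x + x' - sigma y * y') + (sigma x' + x - sigma y' * y)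
     - (sigma x + x - sigma y * y) - (sigma x' + x' - sigma y' * y')); first by ring.
  by rewrite vv vw wv ww; ring.
split=> //; move: vw; rewrite yy -vv => /eqP; rewrite subr_eq addrNK => /eqP.
by move/addrI.
Qed.

Lemma card_isotropic_points (S : {set 'M[F]_4}) :
  S \subset GK_points F ell ->
  (forall v w, v != 0 -> w != 0 -> ppoint v \in S -> ppoint w \in S ->
     herm sigma v w = 0) ->
  (#|S| <= ell ^ 2 - ell + 1)%N.
Proof.
move=> /subsetP S_GK isoS.
(* The point at infinity of the curve pairs to 1 with every representative having T = 1, so it can
   only be the sole point of [S]. *)
have [PinfS|PinfNS] := boolP (ppoint (coords 1 0 0 0) \in S).
  have S_sub : S \subset [set ppoint (coords 1 0 0 0)].
    apply/subsetP => X XS; rewrite inE.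
    have [->|[x [y [z [eX _ _]]]]] := GK_pointsP (S_GK X XS); first exact: eqxx.
    rewrite eX in XS.
    have := isoS _ _ coords_P_infty_neq0 (coords_T1_neq0 _ _ _) PinfS XS.
    rewrite herm_coords !(rmorph0, rmorph1) !mul0r mulr1 addr0 subr0.
    by move/eqP; rewrite oner_eq0.
  by apply: leq_trans (subset_leq_card S_sub) _; rewrite cards1 addn1.
have affine X : X \in S -> exists x y z, X = ppoint (coords x y z 1) /\
    z ^+ (ell ^ 2 - ell + 1) = y ^+ (ell ^ 2) - y.
  move=> XS; have [eX|[x [y [z [eX ez _]]]]] := GK_pointsP (S_GK X XS).
    by rewrite eX (negPf PinfNS) in XS.
  by exists x, y, z.
have [->|[X0 X0S]] := set_0Vmem S; first by rewrite cards0.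
have [x [y [z [eX0 _]]]] := affine X0 X0S.
pose N := (ell ^ 2 - ell)%N; pose d := y ^+ (ell ^ 2) - y.
pose T := [set t | root ('X^(N.+1) - d%:P) t].
have S_sub : S \subset (fun t => ppoint (coords x y t 1)) @: T.
  apply/subsetP => X XS; have [x' [y' [z' [eX ez']]]] := affine X XS.
  have [ex ey] : x' = x /\ y' = y.
    apply: (@herm_isotropic_XY x y z x' y' z').
    by split; apply: isoS; rewrite ?coords_T1_neq0 -?eX0 -?eX.
  rewrite eX ex; rewrite ey in ez' *; apply: (imset_f (fun t => ppoint (coords x y t 1))).
  by rewrite inE /root !hornerE -addn1 ez' subrr.
apply: leq_trans (subset_leq_card S_sub) (leq_trans (leq_imset_card _ _) _).
rewrite -ltnS addn1 -/N.
have := size_XnsubC d (ltn0Sn N) => <-.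
rewrite cardE; apply: max_poly_roots (enum_uniq _).
  by rewrite -size_poly_eq0 size_XnsubC.
by apply/allP => t; rewrite mem_enum inE.
Qed.

Lemma card_line_points (A : 'M[F]_(2, 4)) (S : {set 'M[F]_4}) :
  row_free A -> S \subset GK_points F ell ->
  (forall X, X \in S -> exists2 c : 'rV_2, c != 0 & X = ppoint (c *m A)) ->
  (#|S| <= ell ^ 2 - ell + 1)%N.
Proof.
move=> Afree S_GK SA; have [hA|hA] := eqVneq (herm_poly sigma ell A) 0.
  apply: card_isotropic_points S_GK _ => v w v0 w0 vS wS.
  have [c _ /(ppoint_eq v0)[k _ ->]] := SA _ vS.
  have [d _ /(ppoint_eq w0)[l _ ->]] := SA _ wS.
  by rewrite herm_scale (herm_line_poly0 _ _ ell_gt1 hA) mulr0.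
(* Outside the isotropic case there are at most [ell + 1] points, and [ell + 1 <= ell ^ 2 - ell + 1]
   as [ell >= 2]. *)
suff : (#|S| <= ell.+1 * 1)%N by move/leq_trans; apply; nia.
apply: (card_param_points sigmaE (ltnW ell_gt1) hA Afree S_GK) => X.
move=> /SA[c c0 ->]; have [c00|c00] := eqVneq (c 0 0) 0; [right|left].
  have c1 : c = c 0 ord_max *: delta_mx 0 ord_max.
    apply/rowP => j; rewrite !mxE; case: j => [[|[|//]] hj] /=; last first.
      by rewrite mulr1; congr (c _ _); apply: val_inj.
    by rewrite mulr0 -[RHS]c00; congr (c _ _); apply: val_inj.
  rewrite c1 -scalemxAl -rowE ppoint_scale //.
  by apply: contra_neq c0 => e; rewrite c1 e scale0r.
exists (c 0 ord_max / c 0 0).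
rewrite -[RHS](ppoint_scale _ c00) scalemxAl; congr (ppoint (_ *m _)).
apply/rowP => j; rewrite !mxE; case: j => [[|[|//]] hj] /=.
  by rewrite expr0 mulr1; congr (c _ _); apply: val_inj.
by rewrite expr1 mulrC divfK //; congr (c _ _); apply: val_inj.
Qed.

End Lines.

(** * Linear and quadratic forms as matrices *)

(** The first [\rank V] rows of [row_ebase V] already span the row space of [V]; the first [r] rows
    are independent and include them. *)
Lemma row_free_cover (F : fieldType) m n r (V : 'M[F]_(m, n)) :
  (\rank V <= r <= n)%N -> exists2 N : 'M[F]_(r, n), row_free N & (V <= N)%MS.
Proof.
case/andP => rV rn; exists (pid_mx r *m row_ebase V).
  by rewrite /row_free mxrankMfree ?row_free_unit ?row_ebase_unit // rank_pid_mx.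
rewrite -{1}[V]mulmx_ebase; apply/submxP; exists (col_ebase V *m pid_mx (\rank V)).
rewrite mulmxA -[X in _ = X *m _]mulmxA mul_pid_mx.
by rewrite (minn_idPl rV) (minn_idPr rV).
Qed.

(** As [F] is finite, all rational zeros can be stacked as rows of one matrix [V]. Over [K] it is
    killed by [a], so its rank is at most [n], and the rank is the same over [F]. For [n = 2] this
    replaces a line over [K] by a rational one. *)
Lemma rational_zeros_linear_form (F : finFieldType) (K : fieldType)
    (iota : {rmorphism F -> K}) n (a : 'cV[K]_n.+1) : a != 0 ->
  exists2 N : 'M[F]_(n, n.+1), row_free N &
    forall u : 'rV[F]_n.+1, map_mx iota u *m a = 0 -> (u <= N)%MS.
Proof.
move=> a0; pose V := \matrix_(i < #|{: 'rV[F]_n.+1}|)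
  (if map_mx iota (enum_val i) *m a == 0 then enum_val i else 0).
have Va : map_mx iota V *m a = 0.
  apply/row_matrixP => i; rewrite row_mul -map_row rowK row0.
  by case: eqP => // _; rewrite map_mx0 mul0mx.
have rV : (\rank V <= n)%N.
  have := mulmx0_rank_max Va; rewrite mxrank_map.
  by move: a0; rewrite -mxrank_eq0; lia.
have [N Nfree VN] := row_free_cover (r := n) (V := V) (ltac:(by rewrite rV leqnSn)).
exists N => // u ua; apply: submx_trans VN.
have -> : u = row (enum_rank u) V by rewrite rowK enum_rankK ua eqxx.
exact: row_sub.
Qed.

Lemma rmorph_quadratic_form n (S S' : comNzRingType) (phi : {rmorphism S -> S'})
    (v : 'rV[S]_n) (Q : 'M[S]_n) :
  phi ((v *m Q *m v^T) 0 0) = (map_mx phi v *m map_mx phi Q *m (map_mx phi v)^T) 0 0.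
Proof. by rewrite map_trmx -!map_mxM [RHS]mxE. Qed.

Section Forms.
Variables (n : nat) (R : comNzRingType).

Definition mpoly_vars : 'rV[{mpoly R[n]}]_n := \row_i 'X_i.

Lemma dhomog1_mx (p : {mpoly R[n]}) : p \is 1.-homog ->
  exists a : 'cV[R]_n, p = (mpoly_vars *m map_mx (@mpolyC n R) a) 0 0.
Proof.
move/dhomogP => hp; rewrite [p]mpolyE big_seq.
elim/big_ind: _ => [|_ _ [a ->] [b ->]|m /hp/eqP/mdeg1P[i /eqP ->]].
- by exists 0; rewrite map_mx0 mulmx0 mxE.
- by exists (a + b); rewrite map_mxD mulmxDr [RHS]mxE.
exists (p@_U_(i) *: delta_mx i 0).
by rewrite map_mxZ map_delta_mx -scalemxAr -colE !mxE mul_mpolyC.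
Qed.

(** Each monomial goes to one elementary matrix. [Q] is not made symmetric, which would require
    division by 2 and exclude characteristic 2. *)
Lemma dhomog2_mx (p : {mpoly R[n]}) : p \is 2.-homog ->
  exists Q : 'M[R]_n,
    p = (mpoly_vars *m map_mx (@mpolyC n R) Q *m mpoly_vars^T) 0 0.
Proof.
move/dhomogP => hp; rewrite [p]mpolyE big_seq.
elim/big_ind: _ => [|_ _ [a ->] [b ->]|m /hp].
- by exists 0; rewrite map_mx0 mulmx0 mul0mx mxE.
- by exists (a + b); rewrite map_mxD mulmxDr mulmxDl [RHS]mxE.
move=> m2; have {}m2 : mdeg m = 2%N := m2.
have [i mi] : exists i, m i != 0%N.
  apply/existsP; apply: contraPT m2 => /existsPn m0.
  suff -> : m = 0%MM by rewrite mdeg0.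
  by apply/mnmP => i; apply/eqP; rewrite mnm0E -[_ == _]negbK m0.
have e : (m - U_(i) + U_(i))%MM = m by rewrite submK // lep1mP.
have /eqP/mdeg1P[j /eqP ej] : mdeg (m - U_(i)) = 1%N.
  by have := congr1 mdeg e; rewrite m2 mdegD mdeg1 addn1 => -[].
rewrite ej in e; rewrite -e.
exists (p@_(U_(j) + U_(i)) *: delta_mx j i).
rewrite map_mxZ map_delta_mx -scalemxAr -scalemxAl.
have -> : delta_mx j i = delta_mx j (0 : 'I_1) *m delta_mx 0 i :> 'M[{mpoly R[n]}]_n.
  by rewrite mul_delta_mx.
rewrite !mulmxA -colE -mulmxA -rowE -tr_col.
by rewrite !mxE big_ord1 !mxE mpolyXD mul_mpolyC.
Qed.

Lemma map_meval_vars (u : 'rV[R]_n) :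
  map_mx (meval (fun i => u 0 i)) mpoly_vars = u.
Proof. by apply/rowP => j; rewrite !mxE mevalXU. Qed.

Lemma map_meval_const (v : 'I_n -> R) m k (Q : 'M[R]_(m, k)) :
  map_mx (meval v) (map_mx (@mpolyC n R) Q) = Q.
Proof. by apply/matrixP => i j; rewrite !mxE mevalC. Qed.

Lemma meval_linear_form (u : 'rV[R]_n) (a : 'cV[R]_n) :
  ((mpoly_vars *m map_mx (@mpolyC n R) a) 0 0).@[fun i => u 0 i] = (u *m a) 0 0.
Proof.
transitivity ((map_mx (meval (fun i => u 0 i))
  (mpoly_vars *m map_mx (@mpolyC n R) a)) 0 0); first by rewrite [RHS]mxE.
by rewrite map_mxM map_meval_vars map_meval_const.
Qed.

Lemma meval_quadratic_form (u : 'rV[R]_n) (Q : 'M[R]_n) :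
  ((mpoly_vars *m map_mx (@mpolyC n R) Q *m mpoly_vars^T) 0 0).@[fun i => u 0 i]
  = (u *m Q *m u^T) 0 0.
Proof. by rewrite rmorph_quadratic_form map_meval_vars map_meval_const. Qed.

End Forms.

Lemma map_mpoly_quadratic_form n (R S : comNzRingType) (iota : {rmorphism R -> S})
    (Q : 'M[R]_n) :
  map_mpoly iota ((mpoly_vars n R *m map_mx (@mpolyC n R) Q *m (mpoly_vars n R)^T) 0 0)
  = (mpoly_vars n S *m map_mx (@mpolyC n S) (map_mx iota Q) *m (mpoly_vars n S)^T) 0 0.
Proof.
have vars : map_mx (map_mpoly iota) (mpoly_vars n R) = mpoly_vars n S.
  by apply/rowP => j; rewrite !mxE map_mpolyX.
have consts : map_mx (map_mpoly iota) (map_mx (@mpolyC n R) Q)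
    = map_mx (@mpolyC n S) (map_mx iota Q).
  by apply/matrixP => i j; rewrite !mxE map_mpolyC.
by rewrite rmorph_quadratic_form vars consts.
Qed.

(* The ternary form in question is y0 (l1 y1 + l2 y2) + q11 y1^2 + q12 y1 y2 + q22 y2^2:
   the hypothesis is the vanishing of the resultant of its linear and quadratic
   parts, and the conclusion equates the coefficients of a product of two linear forms. *)
Lemma split_ternary_form (K : closedFieldType) (l1 l2 q11 q12 q22 : K) :
  q11 * l2 ^+ 2 - q12 * l1 * l2 + q22 * l1 ^+ 2 = 0 ->
  exists a0 a1 a2 b0 b1 b2 : K,
    [/\ a0 * b0 = 0, a0 * b1 + a1 * b0 = l1 & a0 * b2 + a2 * b0 = l2] /\
    [/\ a1 * b1 = q11, a1 * b2 + a2 * b1 = q12 & a2 * b2 = q22].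
Proof.
move=> res0.
(* By the vanishing resultant, a nonzero linear part l1 y1 + l2 y2 divides the quadratic part; the
   other factor is y0 plus the quotient. *)
have [l10|l10] := eqVneq l1 0; last first.
  have q22E : q22 = (q12 * l1 * l2 - q11 * l2 ^+ 2) / l1 ^+ 2.
    apply: (canRL (mulfK (expf_neq0 2 l10))).
    by apply/eqP; rewrite -subr_eq0 -res0; apply/eqP; ring.
  exists 0, l1, l2, 1, (q11 / l1), ((q12 - l2 * q11 / l1) / l1).
  by split; split; rewrite ?q22E; field.
have [l20|l20] := eqVneq l2 0; last first.
  have q11E : q11 = (q12 * l1 * l2 - q22 * l1 ^+ 2) / l2 ^+ 2.
    apply: (canRL (mulfK (expf_neq0 2 l20))).
    by apply/eqP; rewrite -subr_eq0 -res0; apply/eqP; ring.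
  exists 0, l1, l2, 1, ((q12 - l1 * q22 / l2) / l2), (q22 / l2).
  by split; split; rewrite ?q11E; field.
have [q0|q0] := eqVneq q11 0.
  exists 0, 0, 1, 0, q12, q22.
  by rewrite l10 l20 q0 !(mul0r, mulr0, add0r, mul1r).
(* Without linear part the form is binary, and a root x of q11 x^2 + q12 x + q22 in the closed field
   [K] splits it as (y1 - x y2) (q11 y1 + (q12 + q11 x) y2). *)
pose c i := if i is 0%N then - q22 / q11 else - q12 / q11.
have [x] := solve_monicpoly c (isT : 0 < 2)%N.
rewrite !big_ord_recl big_ord0 /= addr0 expr0 expr1 mulr1 => ex.
exists 0, 1, (- x), 0, q11, (q12 + q11 * x).
rewrite l10 l20 !(mul0r, mulr0, add0r, mul1r); split; split => //; first by ring.
transitivity (- q12 * x - q11 * x ^+ 2); first by ring.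
by rewrite ex; field.
Qed.

(** * Irreducible conics *)

Section TernaryForms.

Local Notation i0 := (ord0 : 'I_3).
Local Notation i1 := (lift ord0 ord0 : 'I_3).
Local Notation i2 := (lift ord0 (lift ord0 ord0) : 'I_3).

Lemma row3_eq (T : Type) (u v : 'rV[T]_3) :
  u 0 i0 = v 0 i0 -> u 0 i1 = v 0 i1 -> u 0 i2 = v 0 i2 -> u = v.
Proof.
by move=> e0 e1 e2; apply/rowP => j; case/or3P: (ord3_cases j) => /eqP ->.
Qed.

Lemma ternary_formE (S : comNzRingType) (R : 'M[S]_3) (Y : 'rV[S]_3) :
  R i0 i0 = 0 ->
  (Y *m R *m Y^T) 0 0 =
  Y 0 i0 * ((R i0 i1 + R i1 i0) * Y 0 i1 + (R i0 i2 + R i2 i0) * Y 0 i2)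
  + R i1 i1 * Y 0 i1 ^+ 2 + (R i1 i2 + R i2 i1) * Y 0 i1 * Y 0 i2
  + R i2 i2 * Y 0 i2 ^+ 2.
Proof.
move=> R00; do !rewrite ?mxE ?big_ord_recl ?big_ord0 /=.
by rewrite R00; ring.
Qed.

Lemma ternary_form_mul (S : comNzRingType) (R : 'M[S]_3) (Y : 'rV[S]_3) (a b : 'cV[S]_3) :
  R i0 i0 = 0 ->
  [/\ a i0 0 * b i0 0 = 0, a i0 0 * b i1 0 + a i1 0 * b i0 0 = R i0 i1 + R i1 i0
    & a i0 0 * b i2 0 + a i2 0 * b i0 0 = R i0 i2 + R i2 i0] ->
  [/\ a i1 0 * b i1 0 = R i1 i1, a i1 0 * b i2 0 + a i2 0 * b i1 0 = R i1 i2 + R i2 i1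
    & a i2 0 * b i2 0 = R i2 i2] ->
  (Y *m R *m Y^T) 0 0 = (Y *m a) 0 0 * (Y *m b) 0 0.
Proof.
move=> R00 [e0 e1 e2] [e3 e4 e5].
rewrite ternary_formE // -e1 -e2 -e3 -e4 -e5 ![(Y *m _) 0 0]mxE.
rewrite !big_ord_recl !big_ord0 !addr0 -[LHS]add0r -{1}(mul0r (Y 0 i0 ^+ 2)) -{1}e0.
move: (Y 0 i0) (Y 0 i1) (Y 0 i2) (a i0 0) (a i1 0) (a i2 0) (b i0 0) (b i1 0) (b i2 0).
by move=> *; ring.
Qed.

(** The identities are between scalars of [S], while [Y] may have polynomial entries: a
    factorization of coefficients thus becomes one of forms. *)
Lemma map_ternary_form_mul (S S' : comNzRingType) (phi : {rmorphism S -> S'})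
    (R : 'M[S]_3) (Y : 'rV[S']_3) (a b : 'cV[S]_3) :
  R i0 i0 = 0 ->
  [/\ a i0 0 * b i0 0 = 0, a i0 0 * b i1 0 + a i1 0 * b i0 0 = R i0 i1 + R i1 i0
    & a i0 0 * b i2 0 + a i2 0 * b i0 0 = R i0 i2 + R i2 i0] ->
  [/\ a i1 0 * b i1 0 = R i1 i1, a i1 0 * b i2 0 + a i2 0 * b i1 0 = R i1 i2 + R i2 i1
    & a i2 0 * b i2 0 = R i2 i2] ->
  (Y *m map_mx phi R *m Y^T) 0 0 = (Y *m map_mx phi a) 0 0 * (Y *m map_mx phi b) 0 0.
Proof.
move=> R00 [e0 e1 e2] [e3 e4 e5].
have phiR i j : map_mx phi R i j = phi (R i j) by rewrite mxE.
have phia i : map_mx phi a i 0 = phi (a i 0) by rewrite mxE.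
have phib i : map_mx phi b i 0 = phi (b i 0) by rewrite mxE.
apply: ternary_form_mul; rewrite !phiR ?phia ?phib ?R00 ?rmorph0 //.
  by split; rewrite -!rmorphM -?rmorphD ?e0 ?e1 ?e2 ?rmorph0.
by split; rewrite -!rmorphM -?rmorphD ?e3 ?e4 ?e5.
Qed.

Section Parametrization.
Variables (F : fieldType) (l1 l2 q11 q12 q22 : F).

(* [power_row 3 tau *m param_mx] is the second intersection of the conic
   y0 (l1 y1 + l2 y2) + q11 y1^2 + q12 y1 y2 + q22 y2^2 = 0 with the line
   y2 = tau y1 through its point (1 : 0 : 0). *)
Definition param_mx : 'M[F]_3 := \matrix_(i, j)
  (nth [::] [:: [:: - q11; l1; 0]; [:: - q12; l2; l1]; [:: - q22; 0; l2]] i)`_j.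

(** The resultant, as the value of the quadratic part at the zero (l2, - l1) of l1 y1 + l2 y2. *)
Definition param_res := q11 * l2 ^+ 2 - q12 * l1 * l2 + q22 * l1 ^+ 2.

Lemma det_param_mx : \det param_mx = - param_res.
Proof.
rewrite (expand_det_row _ i0) !big_ord_recl big_ord0 /cofactor.
rewrite !(expand_det_row _ ord0) !big_ord_recl !big_ord0 /cofactor !det_mx11.
do !rewrite !mxE /=.
rewrite /bump /param_res /=; ring.
Qed.

(** A point other than (1 : 0 : 0) has parameter tau = y2 / y1, infinite when y1 = 0, which selects
    the last row. The point (1 : 0 : 0) itself is reached along the tangent l1 y1 + l2 y2 = 0. *)
Lemma paramP (y : 'rV[F]_3) : param_res != 0 -> y != 0 ->
  y 0 i0 * (l1 * y 0 i1 + l2 * y 0 i2)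
  + q11 * y 0 i1 ^+ 2 + q12 * y 0 i1 * y 0 i2 + q22 * y 0 i2 ^+ 2 = 0 ->
  (exists k tau, y = k *: (power_row 3 tau *m param_mx)) \/
  (exists k, y = k *: row ord_max param_mx).
Proof.
move=> res0 y0.
have powE tau : power_row 3 tau *m param_mx =
    \row_j [:: - (q11 + q12 * tau + q22 * tau ^+ 2); l1 + l2 * tau; (l1 + l2 * tau) * tau]`_j.
  by apply: row3_eq; do !rewrite ?mxE ?big_ord_recl ?big_ord0 /=; rewrite /bump /=; ring.
have rowE : row ord_max param_mx = \row_j [:: - q22; 0; l2]`_j.
  by apply: row3_eq; rewrite !mxE.
set r := y 0 i0; set s := y 0 i1; set t := y 0 i2 => e.
have y_eq k (v : 'rV_3) : r = k * v 0 i0 -> s = k * v 0 i1 -> t = k * v 0 i2 -> y = k *: v.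
  by move=> *; apply: row3_eq; rewrite [RHS]mxE.
have [s0|s0] := eqVneq s 0; last first.
  have L0 : l1 + l2 * (t / s) != 0.
    apply: contra_neq res0 => /eqP; rewrite addr_eq0 => /eqP l1E.
    rewrite -[RHS](mulr0 ((l2 / s) ^+ 2)) -e /param_res l1E; field.
    exact: s0.
  have Ls : l1 * s + l2 * t != 0.
    by have := mulf_neq0 L0 s0; rewrite mulrDl -mulrA divfK.
  have rE : r = - (q11 * s ^+ 2 + q12 * s * t + q22 * t ^+ 2) / (l1 * s + l2 * t).
    apply: (canRL (mulfK Ls)); apply/eqP; rewrite -subr_eq0 -e; apply/eqP; ring.
  left; exists (s / (l1 + l2 * (t / s))), (t / s).
  rewrite powE; apply: y_eq; rewrite !mxE /= ?rE; field; rewrite ?s0 ?L0 ?Ls //.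
have [t0|t0] := eqVneq t 0; last first.
  have l20 : l2 != 0.
    apply: contra_neq res0 => l20; move/eqP: e.
    rewrite s0 l20 expr0n /= !(mulr0, mul0r, addr0, add0r) mulf_eq0 expf_eq0 (negPf t0) orbF.
    by rewrite /param_res l20 => /eqP ->; ring.
  right; exists (t / l2); rewrite rowE; apply: y_eq; rewrite !mxE /= ?mulr0 ?divfK //.
  apply: (mulIf l20); apply: (mulIf t0); apply/eqP; rewrite -subr_eq0 -e s0; apply/eqP.
  by field.
have r0 : r != 0.
  by apply: contra_neq y0 => r0; apply: row3_eq; rewrite [RHS]mxE.
have [l20|l20] := eqVneq l2 0.
  have q220 : q22 != 0.
    by apply: contra_neq res0 => q220; rewrite /param_res l20 q220; ring.
  right; exists (- r / q22); rewrite rowE l20.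
  by apply: y_eq; rewrite !mxE /= ?mulr0 //; field.
(* At the tangent parameter the quadratic part equals [param_res / l2 ^+ 2], which fixes the
   scale. *)
left; exists (- r * l2 ^+ 2 / param_res), (- l1 / l2).
have L0 : l1 + l2 * (- l1 / l2) = 0 by field.
rewrite powE L0; apply: y_eq; rewrite !mxE /= ?mul0r ?mulr0 //.
rewrite /param_res in res0 *; field; rewrite l20 /=.
exact: res0.
Qed.

End Parametrization.
End TernaryForms.

Section Conics.
Variables (F : finFieldType) (ell : nat) (sigma : {rmorphism F -> F}).
Hypothesis sigmaE : forall x, sigma x = x ^+ ell.
Hypothesis ell_gt1 : (1 < ell)%N.
Variables (K : closedFieldType) (iota : {rmorphism F -> K}).

(** A change of basis moves a point of the conic to (1 : 0 : 0), so the form loses its first square.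
    A zero resultant would split it over [K]; hence the conic is parametrized from that point and
    the root count applies. *)
Lemma card_nonsplit_conic_points (Q : 'M[F]_3) (A : 'M[F]_(3, 4)) (S : {set 'M[F]_4}) :
  (forall a b : 'cV[K]_3,
     (mpoly_vars 3 K *m map_mx (@mpolyC 3 K) (map_mx iota Q) *m (mpoly_vars 3 K)^T) 0 0
     <> (mpoly_vars 3 K *m map_mx (@mpolyC 3 K) a) 0 0
        * (mpoly_vars 3 K *m map_mx (@mpolyC 3 K) b) 0 0) ->
  row_free A -> S \subset GK_points F ell ->
  (forall X, X \in S -> exists u : 'rV_3,
     [/\ u != 0, (u *m Q *m u^T) 0 0 = 0 & X = ppoint (u *m A)]) ->
  (#|S| <= 2 * (ell + 1))%N.
Proof.
move=> nonsplit Afree S_GK SA.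
have [->|[X0 /SA[u0 [u0_neq0 Qu0 _]]]] := set_0Vmem S; first by rewrite cards0.
(* The first row of the invertible matrix [row_ebase u0] is proportional to [u0]. *)
pose G := row_ebase u0; have Gunit : G \in unitmx := row_ebase_unit u0.
pose R := G *m Q *m G^T.
have R00 : R ord0 ord0 = 0.
  have [k k0 u0E] : exists2 k, k != 0 & u0 = k *: row ord0 G.
    exists (col_ebase u0 0 0).
      by have := col_ebase_unit u0; rewrite unitmxE det_mx11 unitfE.
    rewrite -{1}[u0]mulmx_ebase rank_rV u0_neq0 -mulmxA [col_ebase u0]mx11_scalar.
    rewrite mul_scalar_mx mxE rowE; congr (_ *: (_ *m _)).
    by apply/rowP => j; rewrite !mxE; case: j => [[|j] hj].
  have : (row ord0 G *m Q *m (row ord0 G)^T) 0 0 = 0.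
    move: Qu0; rewrite u0E -!scalemxAl linearZ /= -!scalemxAr !mxE => /eqP.
    by rewrite !mulf_eq0 (negPf k0) /= => /eqP.
  move=> <-; rewrite /R !mxE; apply: eq_bigr => j _; rewrite !mxE.
  by congr (_ * _); apply: eq_bigr => k' _; rewrite !mxE.
pose i1 : 'I_3 := lift ord0 ord0; pose i2 : 'I_3 := lift ord0 (lift ord0 ord0).
pose l1 := R ord0 i1 + R i1 ord0; pose l2 := R ord0 i2 + R i2 ord0.
pose q11 := R i1 i1; pose q12 := R i1 i2 + R i2 i1; pose q22 := R i2 i2.
have [res0|res0] := eqVneq (param_res l1 l2 q11 q12 q22) 0.
  have ires0 : param_res (iota l1) (iota l2) (iota q11) (iota q12) (iota q22) = 0.
    by rewrite -(rmorph0 iota) -res0 /param_res !(rmorphD, rmorphN, rmorphM, rmorphXn).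
  have [a0 [a1 [a2 [b0 [b1 [b2 [[e0 e1 e2] [e3 e4 e5]]]]]]]] := split_ternary_form ires0.
  pose P := map_mx iota (invmx G).
  case: (nonsplit (P *m \col_i [:: a0; a1; a2]`_i) (P *m \col_i [:: b0; b1; b2]`_i)).
  have -> : Q = invmx G *m R *m (invmx G)^T.
    by rewrite /R !mulmxA mulVmx // mul1mx -mulmxA -trmx_mul mulVmx // trmx1 mulmx1.
  clearbody R; rewrite !map_mxM -!map_trmx !mulmxA -/P.
  set Y := mpoly_vars 3 K *m map_mx _ P.
  rewrite -[_ *m (map_mx _ P)^T *m _]mulmxA -trmx_mul -/Y.
  clearbody Y; apply: (@map_ternary_form_mul K _ _ (map_mx iota R)).
  - by rewrite mxE R00 rmorph0.
  - by rewrite !mxE /= -!rmorphD.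
  - by rewrite !mxE /= -!rmorphD.
pose B := param_mx l1 l2 q11 q12 q22 *m G *m A.
have Bfree : row_free B.
  rewrite /row_free !mxrankMfree ?row_free_unit // mxrank_unit //.
  by rewrite unitmxE det_param_mx unitfE oppr_eq0.
have : (#|S| <= ell.+1 * 2)%N; last by lia.
apply: (card_param_points sigmaE (ltnW ell_gt1) _ Bfree S_GK) => [|X /SA[u [u0' Qu ->]]].
  exact: herm_poly_conic_neq0 Bfree.
pose y := u *m invmx G.
have uE : u = y *m G by rewrite mulmxKV.
have y0 : y != 0 by apply: contra_neq u0' => y0; rewrite uE y0 mul0mx.
have Ry : (y *m R *m y^T) 0 0 = 0.
  by rewrite /R !mulmxA -uE -mulmxA -trmx_mul -uE.
rewrite ternary_formE // in Ry.
have scaleE k v : y = k *: v -> ppoint (u *m A) = ppoint (v *m G *m A).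
  move=> yE; rewrite uE yE -!scalemxAl ppoint_scale //.
  by apply: contra_neq y0 => k0; rewrite yE k0 scale0r.
have [[k [tau /scaleE ->]]|[k /scaleE ->]] := paramP res0 y0 Ry; [left|right].
  by exists tau; rewrite /B !mulmxA.
by rewrite /B !row_mul.
Qed.

End Conics.

(** * Frobenius powers and the two cases of a plane conic *)

Lemma exists_iter_Frobenius (F : fieldType) p h : p \in [pchar F] ->
  exists sigma : {rmorphism F -> F}, forall x, sigma x = x ^+ (p ^ h).
Proof.
move=> charFp; elim: h => [|h [sigma sigmaE]]; first by exists idfun.
exists (pFrobenius_aut charFp \o sigma)%FUN => x /=.
by rewrite pFrobenius_autE sigmaE -exprM expnSr.
Qed.

Section ConicCounts.

Variables (F : finFieldType) (ell : nat) (sigma : {rmorphism F -> F}).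
Hypothesis sigmaE : forall x, sigma x = x ^+ ell.
Hypothesis ell_gt1 : (1 < ell)%N.
Variables (K : closedFieldType) (iota : {rmorphism F -> K}) (C : plane_conic F).

Lemma conic_form_mx : exists Q : 'M[F]_3,
  conic_form C = (mpoly_vars 3 F *m map_mx (@mpolyC 3 F) Q *m (mpoly_vars 3 F)^T) 0 0.
Proof. exact: dhomog2_mx (conic_form_homog C). Qed.

Lemma card_rational_line_points (a : 'cV[K]_3) (S : {set 'M[F]_4}) :
  a != 0 -> S \subset GK_points F ell ->
  (forall X, X \in S -> exists u : 'rV_3,
     [/\ u != 0, map_mx iota u *m a = 0 & X = ppoint (u *m conic_frame C)]) ->
  (#|S| <= ell ^ 2 - ell + 1)%N.
Proof.
move=> a0 S_GK SA; have [N Nfree aN] := rational_zeros_linear_form iota a0.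
apply: (card_line_points sigmaE ell_gt1 (A := N *m conic_frame C) _ S_GK).
  by rewrite /row_free mxrankMfree ?conic_frame_free.
move=> X /SA[u [u0 /aN/submxP[c uE] ->]]; exists c; last by rewrite uE mulmxA.
by apply: contra_neq u0 => c0; rewrite uE c0 mul0mx.
Qed.

Lemma card_reducible_conic_points : conic_reducible iota C ->
  (#|conic_points C :&: GK_points F ell| <= 2 * (ell ^ 2 - ell + 1))%N.
Proof.
move=> [a [b [a0 b0 /dhomog1_mx[ac aE] /dhomog1_mx[bc bE] fab]]].
have [Q fE] := conic_form_mx; set S := _ :&: _.
have S_GK T : S :&: T \subset GK_points F ell.
  by rewrite /S -setIA subIset // subsetIl orbT.
pose L (c : 'cV[K]_3) := [set X : 'M[F]_4 | [exists u : 'rV_3,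
  [&& u != 0, map_mx iota u *m c == 0 & X == ppoint (u *m conic_frame C)]]].
have cardL c : c != 0 -> (#|S :&: L c| <= ell ^ 2 - ell + 1)%N.
  move=> c0; apply: card_rational_line_points c0 (S_GK _) _ => X.
  rewrite !inE => /andP[_ /existsP[u /and3P[u0 /eqP uc /eqP ->]]].
  by exists u.
have S_sub : S \subset (S :&: L ac) :|: (S :&: L bc).
  apply/subsetP => X XS; rewrite inE !(in_setI _ S) XS /=.
  have /imsetP[u] : X \in conic_points C by move: XS; rewrite inE => /andP[].
  rewrite inE => /andP[u0 /eqP fu] ->.
  have evf : (map_mpoly iota (conic_form C)).@[fun i => map_mx iota u 0 i] = 0.
    rewrite fE map_mpoly_quadratic_form meval_quadratic_form.
    by rewrite -rmorph_quadratic_form -meval_quadratic_form -fE fu rmorph0.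
  have mx0 c : (map_mx iota u *m c) 0 0 = 0 -> map_mx iota u *m c = 0 :> 'M_1.
    by move=> e; apply/matrixP => i j; rewrite !ord1 e mxE.
  move: evf; rewrite fab mevalM aE bE.
  rewrite (meval_linear_form _ ac) (meval_linear_form _ bc) => /eqP.
  rewrite mulf_eq0 => /orP[] /eqP /mx0 /eqP uc; apply/orP; [left|right];
    by rewrite inE; apply/existsP; exists u; rewrite u0 uc eqxx.
have neq0 (c : 'cV[K]_3) p : p != 0 ->
    p = (mpoly_vars 3 K *m map_mx (@mpolyC 3 K) c) 0 0 -> c != 0.
  by move=> p0 pE; apply: contra_neq p0 => c0; rewrite pE c0 map_mx0 mulmx0 mxE.
apply: leq_trans (subset_leq_card S_sub) _.
apply: leq_trans (leq_card_setU _ _) _; rewrite mul2n -addnn.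
by apply: leq_add; apply: cardL; [apply: neq0 aE|apply: neq0 bE].
Qed.

(** Evaluation at the origin is a ring morphism killing every linear form, whereas it would send a
    unit to a unit. *)
Lemma linear_form_not_unit (c : 'cV[K]_3) :
  (mpoly_vars 3 K *m map_mx (@mpolyC 3 K) c) 0 0 \isn't a GRing.unit.
Proof.
apply/negP => /(rmorph_unit (meval (fun i => (0 : 'rV[K]_3) 0 i))) /=.
by rewrite meval_linear_form mul0mx mxE unitr0.
Qed.

(** Were the form a product of two linear forms over [K], irreducibility would make one of them a
    unit, which no linear form is. *)
Lemma card_irreducible_conic_points : conic_abs_irreducible iota C ->
  (#|conic_points C :&: GK_points F ell| <= 2 * (ell + 1))%N.
Proof.
case=> _ _ irr; have [Q fE] := conic_form_mx.
apply: (card_nonsplit_conic_points sigmaE ell_gt1 (iota := iota) (Q := Q)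
  _ (conic_frame_free C) (subsetIr _ _)).
  move=> a b e.
  have [] := irr _ _ (etrans (congr1 _ fE)
      (etrans (map_mpoly_quadratic_form _ _) e));
    exact/negP/linear_form_not_unit.
move=> X; rewrite inE => /andP[/imsetP[u]]; rewrite inE => /andP[u0 /eqP fu] -> _.
by exists u; rewrite u0 -meval_quadratic_form -fE fu.
Qed.

End ConicCounts.

Theorem proposition3p3 (p h ell : nat) (F : finFieldType)
    (K : closedFieldType) (iota : {rmorphism F -> K})
    (p_prime : prime p) (h_ge1 : (1 <= h)%N) (ell_def : ell = (p ^ h)%N)
    (card_F : #|F| = (ell ^ 6)%N)
    (K_algebraic : integralRange iota)
    (C : plane_conic F) :
  (conic_reducible iota C ->
     (#|conic_points C :&: GK_points F ell| <= 2 * (ell ^ 2 - ell + 1))%N)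
  /\
  (conic_abs_irreducible iota C ->
     (#|conic_points C :&: GK_points F ell| <= 2 * (ell + 1))%N).
Proof.
have charFp : p \in [pchar F].
  by apply: (card_finPcharP (n := h * 6)) p_prime; rewrite card_F ell_def expnM.
have [sigma sigmaE] := exists_iter_Frobenius h charFp; rewrite -ell_def in sigmaE.
have ell_gt1 : (1 < ell)%N by rewrite ell_def -(exp1n h) ltn_exp2r ?prime_gt1.
split.
  exact: (card_reducible_conic_points sigmaE).
exact: (card_irreducible_conic_points sigmaE).
Qed.
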